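(* Let ${\sf R}$ be a commutative ring and let $A \in {\sf R}^{n\times n}$. There is an algorithm that computes the adjoint matrix $A^*$ of $A$ using only additions, subtractions and multiplications in ${\sf R}$ (no divisions), and that uses $\tilde{O}(n^3\sqrt{n})$ operations in ${\sf R}$.
   Context: The adjoint (adjugate) matrix $A^*$ is the matrix satisfying $AA^* = A^*A = (\det A) I$; its $(j,i)$ entry equals $\partial \det A / \partial a_{i,j}$ viewed as a polynomial in the entries of $A$. The notation $\tilde{O}(g(n))$ means $O(g(n))$ up to missing factors of the form $\alpha(\log n)^\beta$ for positive real constants $\alpha,\beta$. Operations are counted as arithmetic operations (additions, subtractions, multiplications, and constants from $\mathbb{Z}$) in ${\sf R}$. *)

(* Defs.v *)
From mathcomp Require Import all_boot all_algebra.
Set Implicit Arguments. Unset Strict Implicit. Unset Printing Implicit Defensive.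
Import GRing.Theory.
Local Open Scope ring_scope.

(* Division-free straight-line programs (arithmetic circuits) over a
   commutative ring.  Values are stored in a growing list: the inputs come
   first, then one new value per instruction.  Operands are referenced by
   their index in that list.  Each instruction counts as one ring operation
   (additions, subtractions, multiplications, constants from Z). *)
Inductive instr :=
  | IConst of int
  | IAdd of nat & nat
  | ISub of nat & nat
  | IMul of nat & nat.

Definition step (R : comNzRingType) (vals : seq R) (c : instr) : seq R :=
  rcons vals (match c with
              | IConst z => z%:~R
              | IAdd i j => nth 0 vals i + nth 0 vals j
              | ISub i j => nth 0 vals i - nth 0 vals j
              | IMul i j => nth 0 vals i * nth 0 vals j
              end).

Definition slp_eval (R : comNzRingType) (p : seq instr) (inp : seq R) : seq R :=
  foldl (@step R) inp p.

Definition instr_ok (m : nat) (c : instr) : bool :=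
  match c with
  | IConst _ => true
  | IAdd i j | ISub i j | IMul i j => (i < m)%N && (j < m)%N
  end.

Definition slp_wf (k : nat) (p : seq instr) : bool :=
  all (fun t => instr_ok (k + t.1) t.2) (zip (iota 0 (size p)) p).

Definition slp_cost (p : seq instr) : nat := size p.

(* entries of an n x n matrix in row-major order: index i*n+j holds A i j *)
Definition mx_entries (R : comNzRingType) (n : nat) (A : 'M[R]_n) : seq R :=
  [seq A i j | i <- enum 'I_n, j <- enum 'I_n].

(* Main.v *)
Require Import Defs.
From Stdlib Require Import IndefiniteDescription.
From mathcomp Require Import all_boot all_algebra zify ring mpoly.
Set Implicit Arguments. Unset Strict Implicit. Unset Printing Implicit Defensive.
Import GRing.Theory.
Local Open Scope ring_scope.

(** With q(y) = det(1 - yA) one has adj A = (-1)^(n-1) sum_k q_(n-1-k) A^k, and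
    a polynomial of degree n in A costs O(n^3 sqrt n) by Paterson-Stockmeyer, so
    it is enough to compute q modulo y^M, M = s^2 >= n, s = O(sqrt n).

    Cut A into s x s blocks.  If A_k is the leading k x k submatrix, then
    det(1 - y A_(k+s)) = det(1 - y A_k) det S with the s x s Schur complement
    S = 1 - yD - sum_l y^(l+2) C A_k^l B.  The moments C A_k^l B (l < s^2) are
    the products (C A_k^i)(A_k^(sj) B) with i, j < s, where A_k^s comes from
    repeated squaring; this is O(n^3 log n) for each of the s blocks.  Since
    S = 1 modulo y, Gaussian elimination on S has invertible pivots in
    R[y]/y^M, and uses O(M) multiplications per pivot, its inversion included.

    It remains to multiply in R[y]/y^M with O(M sqrt M) operations and without
    division.  Write f = F(y^s, y), g = G(y^s, y), evaluate the first variable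
    at the powers of the second one modulo y^N - 1, N = q^l = O(s), multiply
    pointwise and transform back, all naively: this is one level of the
    Schoenhage-Strassen algorithm and gives N f g.  Doing it for q = 2 and
    q = 3 and taking an integral combination with coefficients from Bezout's
    identity gives f g. *)

(** * Counting ring operations *)

Section Derivation.
Variable U : comNzRingType.
Implicit Types (X Y Z : U -> Prop) (Phi Psi : (U -> Prop) -> Prop).

(** [X] is the set of values already computed. Working with sets avoids index bookkeeping until
    [chain_slp] turns a chain into a program. *)
Definition one_step X x :=
  (exists z : int, x = z%:~R) \/
  exists a b, [/\ X a, X b & [\/ x = a + b, x = a - b | x = a * b]].

Fixpoint chain X (L : seq U) : Prop :=
  if L is x :: L' then one_step X x /\ chain (fun u => X u \/ u = x) L'
  else True.

Definition incl X Y := forall u, X u -> Y u.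

(* Quantifying over all supersets [Z] makes every postcondition monotone, so
   that facts established earlier survive later steps. *)
Definition derives X (c : nat) Phi :=
  exists L : seq U, [/\ (size L <= c)%N, chain X L &
    forall Z, incl X Z -> (forall u, u \in L -> Z u) -> Phi Z].

Lemma incl_trans Y X Z : incl X Y -> incl Y Z -> incl X Z.
Proof. by move=> sXY sYZ u /sXY /sYZ. Qed.

Lemma chain_incl X Y L : incl X Y -> chain X L -> chain Y L.
Proof.
elim: L X Y => //= x L IH X Y sXY [hx hL]; split.
  case: hx => [[z ->]|[a [b [Xa Xb e]]]]; first by left; exists z.
  by right; exists a, b; split; auto.
by apply: IH hL => u [/sXY|]; [left|right].
Qed.

Lemma chain_cat X L1 L2 :
  chain X L1 -> chain (fun u => X u \/ u \in L1) L2 -> chain X (L1 ++ L2).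
Proof.
elim: L1 X => /= [|x L1 IH] X.
  by move=> _; apply: chain_incl => u [].
case=> hx hL1 hL2; split=> //; apply: IH => //.
apply: chain_incl hL2 => u [Xu|]; first by left; left.
by rewrite inE => /predU1P[->|uL]; [left; right|right].
Qed.

Lemma derives_ret X c Phi : (forall Z, incl X Z -> Phi Z) -> derives X c Phi.
Proof. by move=> h; exists [::]; split=> // Z sXZ _; apply: h. Qed.

Lemma derives_le X c' c Phi : derives X c' Phi -> (c' <= c)%N -> derives X c Phi.
Proof.
by case=> L [szL chL hL] le_c; exists L; split=> //; apply: leq_trans le_c.
Qed.

Lemma derives_imp X c Phi Psi :
  (forall Z, incl X Z -> Phi Z -> Psi Z) -> derives X c Phi -> derives X c Psi.
Proof.
move=> h [L [szL chL hL]]; exists L; split=> // Z sXZ sLZ.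
by apply: h => //; apply: hL.
Qed.

Lemma derives_bind X c1 c2 Phi Psi :
  derives X c1 Phi ->
  (forall Y, incl X Y -> Phi Y -> derives Y c2 Psi) ->
  derives X (c1 + c2) Psi.
Proof.
case=> L1 [sz1 ch1 h1] /(_ (fun u => X u \/ u \in L1)) [].
- by move=> u; left.
- by apply: h1 => [u|u]; [left|right].
move=> L2 [sz2 ch2 h2]; exists (L1 ++ L2); split.
- by rewrite size_cat leq_add.
- exact: chain_cat.
move=> Z sXZ sLZ; apply: h2 => [u []|u uL]; first exact: sXZ.
  by move=> uL; apply: sLZ; rewrite mem_cat uL.
by apply: sLZ; rewrite mem_cat uL orbT.
Qed.

(** All the computations start from [X], and a chain stays valid over a larger set, so their chains
    can be concatenated. *)
Lemma derives_all_seq (I : eqType) (r : seq I) X c (Phi : I -> (U -> Prop) -> Prop) :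
  (forall i, i \in r -> derives X c (Phi i)) ->
  derives X (size r * c) (fun Z => forall i, i \in r -> Phi i Z).
Proof.
elim: r => [|i r IH] h /=; first exact: derives_ret.
rewrite mulSn.
have [L1 [sz1 ch1 h1]] := h i (mem_head _ _).
have [j jr|L2 [sz2 ch2 h2]] := IH; first by apply: h; rewrite inE jr orbT.
exists (L1 ++ L2); split.
- by rewrite size_cat leq_add.
- by apply: chain_cat => //; apply: chain_incl ch2 => u; left.
move=> Z sXZ sLZ j; rewrite inE => /predU1P[->|jr].
  by apply: h1 => // u uL; apply: sLZ; rewrite mem_cat uL.
by apply: h2 => // u uL; apply: sLZ; rewrite mem_cat uL orbT.
Qed.

Lemma derives_all (I : finType) X c (Phi : I -> (U -> Prop) -> Prop) :
  (forall i, derives X c (Phi i)) ->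
  derives X (#|I| * c) (fun Z => forall i, Phi i Z).
Proof.
move=> h; rewrite cardE.
apply: derives_imp (derives_all_seq (r := enum I) (fun i _ => h i)).
by move=> Z _ hZ i; apply: hZ; rewrite mem_enum.
Qed.

Lemma derives_all2 (I J : finType) X c (Phi : I -> J -> (U -> Prop) -> Prop) :
  (forall i j, derives X c (Phi i j)) ->
  derives X (#|I| * #|J| * c) (fun Z => forall i j, Phi i j Z).
Proof. by move=> h; rewrite -mulnA; apply: derives_all => i; apply: derives_all. Qed.

Lemma derives_iter n X c (Phi : nat -> (U -> Prop) -> Prop) :
  Phi 0%N X ->
  (forall i Y, (i < n)%N -> incl X Y -> Phi i Y -> derives Y c (Phi i.+1)) ->
  (forall i Y Z, incl Y Z -> Phi i Y -> Phi i Z) ->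
  derives X (n * c) (Phi n).
Proof.
move=> h0 hS hm.
suff h k : (k <= n)%N -> derives X (k * c) (Phi k) by apply: h.
elim: k => [|k IH] lt_kn; first by apply: derives_ret => Z sXZ; apply: hm h0.
rewrite mulSn addnC; apply: derives_bind (IH (ltnW lt_kn)) _ => Y sXY hY.
exact: hS.
Qed.

Lemma derives_step X x Phi :
  one_step X x -> (forall Z, incl X Z -> Z x -> Phi Z) -> derives X 1 Phi.
Proof.
move=> hx h; exists [:: x]; split=> // Z sXZ sLZ.
by apply: h => //; apply: sLZ; rewrite inE.
Qed.

Lemma derives_const X (z : int) : derives X 1 (fun Z => Z z%:~R).
Proof. by apply: (@derives_step _ z%:~R) => //; left; exists z. Qed.

Lemma derives_add X a b : X a -> X b -> derives X 1 (fun Z => Z (a + b)).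
Proof.
move=> Xa Xb; apply: (@derives_step _ (a + b)) => //.
by right; exists a, b; split=> //; constructor 1.
Qed.

Lemma derives_sub X a b : X a -> X b -> derives X 1 (fun Z => Z (a - b)).
Proof.
move=> Xa Xb; apply: (@derives_step _ (a - b)) => //.
by right; exists a, b; split=> //; constructor 2.
Qed.

Lemma derives_mul X a b : X a -> X b -> derives X 1 (fun Z => Z (a * b)).
Proof.
move=> Xa Xb; apply: (@derives_step _ (a * b)) => //.
by right; exists a, b; split=> //; constructor 3.
Qed.

Lemma derives_sum (I : finType) X (F : I -> U) :
  X 0 -> (forall i, X (F i)) -> derives X #|I| (fun Z => Z (\sum_i F i)).
Proof.
move=> X0 XF; rewrite -big_enum cardE.
elim: (enum I) => [|i r IH] /=.
  by rewrite big_nil; apply: derives_ret => Z; apply.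
rewrite big_cons -addn1; apply: derives_bind IH _ => Y sXY hY.
by apply: derives_add => //; apply: sXY.
Qed.

Lemma derives_dot (I : finType) X (F G : I -> U) :
  X 0 -> (forall i, X (F i)) -> (forall i, X (G i)) ->
  derives X (2 * #|I|) (fun Z => Z (\sum_i F i * G i)).
Proof.
move=> X0 XF XG; rewrite mul2n -addnn -{1}[#|I|]muln1.
apply: (derives_bind (Phi := fun Z => forall i, Z (F i * G i))).
  by apply: derives_all => i; apply: derives_mul.
by move=> Y sXY hY; apply: derives_sum => //; apply: sXY.
Qed.

Definition mxin m n X (A : 'M[U]_(m, n)) := forall i j, X (A i j).

Lemma mxin_incl m n X Y (A : 'M[U]_(m, n)) : incl X Y -> mxin X A -> mxin Y A.
Proof. by move=> sXY h i j; apply/sXY/h. Qed.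

Lemma derives_mulmx m p n X (A : 'M[U]_(m, p)) (B : 'M_(p, n)) :
  X 0 -> mxin X A -> mxin X B ->
  derives X (m * n * (2 * p)) (fun Z => mxin Z (A *m B)).
Proof.
move=> X0 XA XB; rewrite -{1}[m]card_ord -{1}[n]card_ord -{1}[p]card_ord.
apply: derives_all2 => i j; rewrite mxE.
exact: derives_dot.
Qed.

Lemma derives_addmx m n X (A B : 'M[U]_(m, n)) :
  mxin X A -> mxin X B -> derives X (m * n) (fun Z => mxin Z (A + B)).
Proof.
move=> XA XB; rewrite -[(m * n)%N]muln1 -{1}[m]card_ord -{1}[n]card_ord.
apply: derives_all2 => i j; rewrite mxE.
exact: derives_add.
Qed.

End Derivation.

(** * Multiplication of polynomials *)

(* [F : I -> I -> U] stands for a polynomial in [x] whose coefficients lie in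
   the group ring of [I]; [fourier F i] is its value at [x = y^i]. *)
Section CyclicConvolution.
Variables (U : comNzRingType) (I : finComNzRingType).
Implicit Types (F G H : I -> I -> U) (w c t : I).

(** Product with the exponents of both [x] and [y] taken in [I]. Below, [conv1] multiplies values in
    the group ring, and [inv_fourier] evaluates at the inverse powers of [y], without dividing by
    [#|I|]. *)
Definition conv2 F G c t : U := \sum_a \sum_s F a s * G (c - a) (t - s).

Definition fourier F i t : U := \sum_a F a (t - i * a).

Definition conv1 F G i t : U := \sum_s F i s * G i (t - s).

Definition inv_fourier H c t : U := \sum_i H i (t + i * c).

(* In the double sum over [a], [b] the terms with [e = c - a - b != 0] are
   invariant under the translation [t -> t - w], because [w] is a multiple of
   [e]; hence the difference keeps only [b = c - a]. *)
Lemma fourier_conv F G w c t :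
  (forall e : I, e != 0 -> exists i, i * e = w) ->
  (forall a b s, F a s * G b (t - w - s) = 0) ->
  let T := inv_fourier (conv1 (fourier F) (fourier G)) in
  T c t - T c (t - w) = #|I|%:R * conv2 F G c t.
Proof.
move=> hw hFG T.
have TE u : T c u =
    \sum_a \sum_s F a s * \sum_b \sum_i G b (u - s + i * (c - a - b)).
  rewrite /T /inv_fourier /conv1 /fourier.
  transitivity (\sum_i \sum_a \sum_s \sum_b
      F a s * G b (u - s + i * (c - a - b))).
    apply: eq_bigr => i _.
    under eq_bigr => s _ do rewrite mulr_suml.
    rewrite exchange_big; apply: eq_bigr => a _.
    (* This shift of [s] undoes the multiplication by [y^(i a)] in [fourier F]. *)
    rewrite (reindex_inj (addIr (i * a))) /=; apply: eq_bigr => s _.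
    rewrite mulr_sumr; apply: eq_bigr => b _.
    by congr (F _ _ * G _ _); ring.
  rewrite exchange_big; apply: eq_bigr => a _.
  rewrite exchange_big; apply: eq_bigr => s _.
  rewrite exchange_big mulr_sumr; apply: eq_bigr => b _.
  by rewrite mulr_sumr.
rewrite !TE -sumrB /conv2 mulr_sumr; apply: eq_bigr => a _.
rewrite -sumrB mulr_sumr; apply: eq_bigr => s _.
rewrite -mulrBr -sumrB (bigD1 (c - a)) //= [X in _ + X]big1 => [|b neb].
  (* For [b = c - a] the summand does not depend on [i], which produces [#|I|]; [hFG] removes the
     copy shifted by [w]. *)
  rewrite addr0 subrr.
  under eq_bigr => i _ do rewrite mulr0 addr0.
  under [X in _ - X]eq_bigr => i _ do rewrite mulr0 addr0.
  by rewrite !sumr_const mulrBr mulrnAr mulrnAr hFG mul0rn subr0 mulr_natl.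
have [|i0 hi0] := hw (c - a - b); first by rewrite subr_eq0 eq_sym.
apply/eqP; rewrite subr_eq0; apply/eqP; apply/esym.
rewrite (reindex_inj (addIr i0)) /=; apply: eq_bigr => i _.
by rewrite mulrDl hi0; congr (G _ _); ring.
Qed.

Definition in2 (X : U -> Prop) F := forall i t, X (F i t).

(** Multiplying by a power of [y] only moves indices, so the three transforms cost additions alone.
    All differences are computed, but only those without a shifted copy are entries of the
    product. *)
Lemma derives_scaled_conv2 X F G w :
  X 0 -> in2 X F -> in2 X G ->
  (forall e : I, e != 0 -> exists i, i * e = w) ->
  derives X (6 * #|I| ^ 3) (fun Z => forall c t,
    (forall a b s, F a s * G b (t - w - s) = 0) ->
    Z (#|I|%:R * conv2 F G c t)).
Proof.
move=> X0 XF XG hw; set N := #|I|.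
have N_gt0 : (0 < N)%N by apply/card_gt0P; exists 0.
have D2 (c : nat) (H : I -> I -> U) (Y : U -> Prop) :
    (forall i t, derives Y c (fun Z => Z (H i t))) ->
    derives Y (N * N * c) (fun Z => in2 Z H).
  exact: derives_all2.
have -> : (6 * N ^ 3 =
  N * N * N + (N * N * N + (N * N * (2 * N) + (N * N * N + N * N * N))))%N.
  by lia.
apply: derives_bind (D2 _ (fourier F) _ _) _ => [i t|X1 s1 h1].
  exact: derives_sum.
apply: derives_bind (D2 _ (fourier G) _ _) _ => [i t|X2 s2 h2].
  by apply: derives_sum; auto.
apply: derives_bind (D2 _ (conv1 (fourier F) (fourier G)) _ _) _ => [i t|X3 s3 h3].
  by apply: derives_dot; auto.
apply: derives_bind (D2 _ (inv_fourier _) _ _) _ => [c t|X4 s4 h4].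
  by apply: derives_sum => [|i]; [auto | apply: h3].
apply: (@derives_le _ _ (N * N * 1)); last by nia.
apply: derives_imp; last first.
  apply: derives_all2 => c t.
  exact: derives_sub (h4 c t) (h4 c (t - w)).
by move=> Z _ hZ c t ht; rewrite -(fourier_conv c hw ht).
Qed.

End CyclicConvolution.

(** Modulo a prime power, [gcd(e, q^(l+1))] is some [q^k] with [k <= l], so [q^l] lies in every
    nonzero ideal. This supplies the common multiple [w] of [fourier_conv]. *)
Lemma Zp_pfactor_mul (q l : nat) (e : 'Z_(q ^ l.+1)) :
  prime q -> e != 0 -> exists i, i * e = (q ^ l)%:R.
Proof.
move=> pq e0; set N := (q ^ l.+1)%N in e e0 *.
have N_gt1 : (1 < N)%N by rewrite -(exp1n l.+1) ltn_exp2r ?prime_gt1.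
have e_gt0 : (0 < e)%N by rewrite lt0n.
have [k le_kl Ek] : exists2 k, (k <= l)%N & gcdn e N = (q ^ k)%N.
  have /(dvdn_pfactor _ _ pq)[k le_kl Ek] := dvdn_gcdr e N.
  exists k => //; rewrite leqNgt; apply/negP => lt_lk.
  have Ek' : k = l.+1 by apply/eqP; rewrite eqn_leq le_kl.
  have := dvdn_gcdl e N; rewrite Ek Ek' => /(dvdn_leq e_gt0).
  by rewrite leqNgt -[X in (_ < X)%N](Zp_cast N_gt1) ltn_ord.
have [a b Eab _] := egcdnP N e_gt0.
have Eae : (a * e)%:R = (q ^ k)%:R :> 'Z_N.
  by rewrite Eab Ek natrD natrM pchar_Zp // mulr0 add0r.
exists (a%:R * (q ^ (l - k))%:R).
by rewrite -[e]natr_Zp mulrAC -natrM Eae -natrM -expnD subnKC.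
Qed.

(** * Polynomial products by splitting into two variables *)

Section PolyMul.
Variable U : comNzRingType.

(* [split_poly N s f a t] is the coefficient of [x^a y^t] in the bivariate
   polynomial [F] of degree [< s] in each variable with [f = F(y^s, y)]. *)
Definition split_poly N s (f : {poly U}) (a t : 'Z_N) : U :=
  if (a < s)%N && (t < s)%N then f`_(s * a + t) else 0.

Lemma split_polyE N s (f : {poly U}) :
  (1 < N)%N -> (s <= N)%N -> (0 < s)%N -> (size f <= s * s)%N ->
  f = \sum_a \sum_t @split_poly N s f a t *: 'X^(s * a + t).
Proof.
move=> N1 le_sN s0 szf; apply/polyP=> k.
rewrite coef_sum; under eq_bigr => a _ do rewrite coef_sum.
have E i : (i < s)%N -> exists j : 'Z_N, j = i :> nat.
  move=> lt_is; exists (inZp i); rewrite /= modn_small // Zp_cast //.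
  exact: leq_trans le_sN.
have lt_mod : (k %% s < s)%N by rewrite ltn_mod.
have [lt_k|le_k] := ltnP k (s * s); last first.
  rewrite nth_default ?(leq_trans szf) // big1 // => a _; rewrite big1 // => t _.
  rewrite coefZ coefXn /split_poly; case: ifP => [/andP[ha ht]|_]; last by rewrite mul0r.
  case: eqP => [Ek|_]; last by rewrite mulr0.
  by exfalso; nia.
have lt_div : (k %/ s < s)%N by rewrite ltn_divLR.
have [[d Ed] [m Em]] := (E _ lt_div, E _ lt_mod).
rewrite (bigD1 d) //= [X in _ + X]big1 => [|a nea]; last first.
  rewrite big1 // => t _; rewrite coefZ coefXn /split_poly.
  case: ifP => [/andP[ha ht]|_]; last by rewrite mul0r.
  case: eqP => [Ek|_]; last by rewrite mulr0.
  case/eqP: nea; apply/ord_inj; rewrite Ed.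
  by rewrite Ek mulnC divnMDl // divn_small ?addn0.
rewrite addr0 (bigD1 m) //= [X in _ + X]big1 => [|t net]; last first.
  rewrite coefZ coefXn /split_poly; case: ifP => [/andP[_ ht]|_]; last by rewrite mul0r.
  case: eqP => [Ek|_]; last by rewrite mulr0.
  by case/eqP: net; apply/ord_inj; rewrite Em Ek mulnC modnMDl modn_small.
rewrite addr0 coefZ coefXn /split_poly Ed Em lt_div lt_mod mulnC -divn_eq.
by rewrite eqxx mulr1.
Qed.

Lemma modn_Zp N x : (1 < N)%N -> (x < N)%N -> (x %% (Zp_trunc N).+2)%N = x.
Proof. by move=> N1 ltx; rewrite Zp_cast // modn_small. Qed.

(** Exponents below [s] never wrap around modulo [N], so the cyclic product of split polynomials is
    the true one. *)
Lemma val_add_small N s (a b : 'Z_N) : (1 < N)%N -> (2 * s <= N)%N ->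
  (a < s)%N -> (b < s)%N -> (a + b : 'Z_N) = (a + b)%N :> nat.
Proof. by move=> N1 le2 ha hb; rewrite /= modn_Zp //; lia. Qed.

Lemma conv2_split_polyE N s (f g : {poly U}) :
  (1 < N)%N -> (2 * s <= N)%N -> (0 < s)%N ->
  (size f <= s * s)%N -> (size g <= s * s)%N ->
  f * g = \sum_c \sum_t conv2 (@split_poly N s f) (@split_poly N s g) c t
            *: 'X^(s * c + t).
Proof.
move=> N1 le2 s0 szf szg; have le1 : (s <= N)%N by lia.
transitivity (\sum_a \sum_u \sum_c \sum_t
  (@split_poly N s f a u * @split_poly N s g (c - a) (t - u)) *: 'X^(s * c + t)).
  rewrite {1}[f](split_polyE N1 le1 s0 szf) {1}[g](split_polyE N1 le1 s0 szg).
  rewrite mulr_suml; apply: eq_bigr => a _.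
  rewrite mulr_suml; apply: eq_bigr => u _.
  rewrite mulr_sumr [RHS](reindex_inj (addIr a)) /=; apply: eq_bigr => b _.
  rewrite mulr_sumr [RHS](reindex_inj (addIr u)) /=; apply: eq_bigr => t _.
  rewrite !addrK -scalerAl -scalerAr scalerA -exprD.
  rewrite /split_poly; case: ifP => [/andP[ha hu]|_]; last by rewrite !mul0r !scale0r.
  case: ifP => [/andP[hb ht]|_]; last by rewrite !mulr0 !scale0r.
  have /= Eba := val_add_small N1 le2 hb ha.
  have /= Etu := val_add_small N1 le2 ht hu.
  by congr (_ *: 'X^_); rewrite /= Eba Etu; lia.
rewrite exchange_big /=; under eq_bigr => u _ do rewrite exchange_big.
rewrite exchange_big /=; apply: eq_bigr => c _.
under eq_bigr => u _ do rewrite exchange_big.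
rewrite exchange_big /=; apply: eq_bigr => t _.
rewrite /conv2 scaler_suml exchange_big /=; apply: eq_bigr => a _.
by rewrite scaler_suml.
Qed.

Lemma conv2_split_poly_eq0 N s (f g : {poly U}) (c t : 'Z_N) :
  (1 < N)%N -> (2 * s <= N)%N -> (2 * s <= t)%N ->
  conv2 (@split_poly N s f) (@split_poly N s g) c t = 0.
Proof.
move=> N1 le2 le_t; rewrite /conv2 big1 // => a _; rewrite big1 // => u _.
rewrite /split_poly; case: ifP => [/andP[_ hu]|_]; last by rewrite mul0r.
case: ifP => [/andP[_ hv]|_]; last by rewrite mulr0.
have := val_add_small N1 le2 hv hu; rewrite subrK => Et.
by exfalso; lia.
Qed.

(** Only the entries with [t < w] will be available. The others vanish, since the degree in [y]
    stays below [2 * s <= w], so each coefficient is a sum of at most [N] known entries. *)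
Lemma coefM_conv2 N s w (f g : {poly U}) k :
  (1 < N)%N -> (2 * s <= w)%N -> (w <= N)%N -> (0 < s)%N ->
  (size f <= s * s)%N -> (size g <= s * s)%N ->
  (f * g)`_k = \sum_(c : 'Z_N)
    if (s * c <= k < s * c + w)%N
    then conv2 (@split_poly N s f) (@split_poly N s g) c (inZp (k - s * c))
    else 0.
Proof.
move=> N1 le2w lewN s0 szf szg; have le2 : (2 * s <= N)%N by lia.
rewrite (conv2_split_polyE N1 le2 s0 szf szg) coef_sum; apply: eq_bigr => c _.
rewrite coef_sum; case: ifP => [/andP[h1 h2]|hk].
  have E : (inZp (k - s * c) : 'Z_N) = (k - s * c)%N :> nat.
    by rewrite /= modn_Zp //; lia.
  move: (inZp _ : 'Z_N) E => d E; rewrite (bigD1 d) //= [X in _ + X]big1 => [|t net].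
    by rewrite addr0 coefZ coefXn E subnKC // eqxx mulr1.
  rewrite coefZ coefXn; case: eqP => [Ek|_]; last by rewrite mulr0.
  by case/eqP: net; apply/ord_inj; rewrite E; lia.
apply: big1 => t _; rewrite coefZ coefXn; case: eqP => [Ek|_]; last by rewrite mulr0.
rewrite conv2_split_poly_eq0 ?mul0r //.
by move/negbT: hk; lia.
Qed.

Definition polyin (X : U -> Prop) (p : {poly U}) := forall k, X p`_k.

(** The modulus has one factor [q] more than [q^l >= 2 * s]: the copy shifted by [w = q^l] then
    misses the range [t < q^l] that holds the whole product. *)
Lemma derives_scaled_mul_poly q X s (f g : {poly U}) : prime q -> (0 < s)%N ->
  X 0 -> polyin X f -> polyin X g ->
  (size f <= s * s)%N -> (size g <= s * s)%N ->
  let N := (q ^ (up_log q (2 * s)).+1)%N in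
  derives X (6 * (2 * s * q ^ 2) ^ 3 + s * s * (2 * s * q ^ 2))
    (fun Z => forall k : 'I_(s * s), Z (N%:R * (f * g)`_k)).
Proof.
move=> pq s0 X0 Xf Xg szf szg; set l := up_log q (2 * s); move=> N.
have q1 := prime_gt1 pq.
have le_w : (2 * s <= q ^ l)%N by apply: up_logP.
have lt_w : (q ^ l <= 2 * s * q)%N.
  have : (0 < l)%N by rewrite up_log_gt0 q1; lia.
  have : (q ^ l.-1 < 2 * s)%N by apply: up_log_gtn => //; lia.
  by case: (l) => //= l' /ltnW h _; rewrite expnS mulnC leq_mul2r h orbT.
have EN : N = (q * q ^ l)%N by rewrite -expnS.
have N1 : (1 < N)%N by rewrite EN; nia.
have leN : (N <= 2 * s * q ^ 2)%N by rewrite EN expnS expn1 mulnC mulnA leq_mul.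
have cN : #|'Z_N| = N by rewrite card_ord Zp_cast.
set F := @split_poly N s f; set G := @split_poly N s g.
have XF : in2 X F by move=> a t; rewrite /F /split_poly; case: ifP.
have XG : in2 X G by move=> a t; rewrite /G /split_poly; case: ifP.
apply: (@derives_le _ _ (6 * N ^ 3 + s * s * N)); last first.
  by rewrite leq_add ?leq_mul // leq_exp2r.
apply: (derives_bind (Phi := fun Z => forall c t : 'Z_N, (t < q ^ l)%N ->
   Z (N%:R * conv2 F G c t))) => [|Y sXY hY].
  rewrite -{1}cN.
  apply: derives_imp (derives_scaled_conv2 X0 XF XG (fun e => Zp_pfactor_mul pq)).
  move=> Z _ hZ c t ht; rewrite -{1}cN; apply: hZ => a b u.
  rewrite {1}/F /split_poly; case: ifP => [/andP[_ hu]|_]; last by rewrite mul0r.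
  rewrite /G /split_poly; case: ifP => [/andP[_ hv]|_]; last by rewrite mulr0.
  have le2 : (2 * s <= N)%N by rewrite EN; nia.
  set v := t - _ - u in hv; set x : 'Z_N := (q ^ l)%:R.
  have Ex : x = (q ^ l)%N :> nat.
    by rewrite /x Zp_nat /= modn_Zp // EN; nia.
  have Et : (v + u + x : 'Z_N) = t by rewrite /v -/x; ring.
  clearbody v x; have /= Evu := val_add_small N1 le2 hv hu.
  move/(congr1 (@nat_of_ord _)): Et => /=.
  (* As [u + v < 2 * s <= q ^ l] and [2 * q ^ l <= N], nothing wraps around, so [t >= q ^ l],
     against [ht]. *)
  rewrite Evu Ex modn_Zp // => [Et|]; last by nia.
  by exfalso; lia.
apply: (@derives_le _ _ (#|'I_(s * s)| * #|'Z_N|)); last by rewrite card_ord cN.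
apply: derives_all => k.
rewrite (coefM_conv2 k N1 le_w _ s0 szf szg); last by rewrite EN; nia.
rewrite mulr_sumr; apply: derives_sum => [|c]; first exact: sXY.
case: ifP => [/andP[h1 h2]|_]; last by rewrite mulr0; apply: sXY.
by apply: hY; rewrite /= modn_Zp ?EN //; nia.
Qed.

Lemma derives_mul_poly X s (f g : {poly U}) : (0 < s)%N ->
  X 0 -> polyin X f -> polyin X g ->
  (size f <= s * s)%N -> (size g <= s * s)%N ->
  derives X (18 ^ 4 * s ^ 3) (fun Z => forall k : 'I_(s * s), Z (f * g)`_k).
Proof.
move=> s0 X0 Xf Xg szf szg.
set N2 := (2 ^ (up_log 2 (2 * s)).+1)%N; set N3 := (3 ^ (up_log 3 (2 * s)).+1)%N.
have /coprimezP[[u v] /= Euv] : coprimez N2 N3.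
  by rewrite coprimezE /= /N2 /N3 coprimeXl // coprimeXr.
pose c q := (6 * (2 * s * q ^ 2) ^ 3 + s * s * (2 * s * q ^ 2))%N.
(* The term [6 * (18 * s) ^ 3] from [q = 3] dominates; [18 ^ 4] is a generous round bound. *)
apply: (@derives_le _ _ (c 2 + (c 3 + (1 + (1 + s * s * (1 + (1 + 1)))))))%N; last first.
  rewrite /c; nia.
apply: derives_bind (derives_scaled_mul_poly (q := 2) _ s0 X0 Xf Xg szf szg) _ => // X1 s1 h1.
apply: derives_bind (derives_scaled_mul_poly (q := 3) _ s0 (s1 _ X0) _ _ szf szg) _ => //.
- by move=> k; apply/s1/Xf.
- by move=> k; apply/s1/Xg.
move=> X2 s2 h2; apply: derives_bind (derives_const _ u) _ => X3 s3 hu.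
apply: derives_bind (derives_const _ v) _ => X4 s4 hv.
rewrite -{1}[(s * s)%N]card_ord; apply: derives_all => k.
have -> : (f * g)`_k =
    u%:~R * (N2%:R * (f * g)`_k) + v%:~R * (N3%:R * (f * g)`_k).
  rewrite !mulrA -mulrDl !pmulrn -!intrM -intrD Euv mul1r //.
apply: derives_bind (derives_mul (s4 _ hu) (s4 _ (s3 _ (s2 _ (h1 k))))) _ => X5 s5 h5.
apply: derives_bind (derives_mul (s5 _ hv) (s5 _ (s4 _ (s3 _ (h2 k))))) _ => X6 s6 h6.
exact: derives_add (s6 _ h5) h6.
Qed.

End PolyMul.

(** * Determinants of truncated power series *)

Lemma det_schur (R : comNzRingType) m n (P Q : 'M[R]_m) (B : 'M_(m, n))
    (C : 'M_(n, m)) (D : 'M_n) :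
  P *m Q = 1%:M -> \det (block_mx P B C D) = \det P * \det (D - C *m Q *m B).
Proof.
move=> PQ; have QP := mulmx1C PQ.
have -> : block_mx P B C D =
    block_mx P 0 C 1%:M *m block_mx 1%:M (Q *m B) 0 (D - C *m Q *m B).
  rewrite mulmx_block !mulmx1 !mul0mx !mulmx0 !addr0 mul1mx.
  by rewrite !mulmxA PQ mul1mx addrC subrK.
by rewrite det_mulmx det_lblock det_ublock !det1 mulr1 mul1r.
Qed.

Section TruncatedPoly.
Variables (U : comNzRingType) (M : nat).
Hypothesis M_gt0 : (0 < M)%N.

Local Notation T := {poly %/ ('X^M : {poly U})}.
Local Notation trunc := (in_qpoly ('X^M : {poly U})).

Lemma mk_monic_Xn_gt0 : mk_monic 'X^M = 'X^M :> {poly U}.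
Proof. by rewrite mk_monic_Xn prednK. Qed.

Lemma coef_trunc (p : {poly U}) k :
  (trunc p : {poly U})`_k = if (k < M)%N then p`_k else 0.
Proof. by rewrite /= mk_monic_Xn_gt0 -Pdiv.RingMonic.take_poly_rmodp coef_take_poly. Qed.

Lemma size_trunc (t : T) : (size (t : {poly U}) <= M)%N.
Proof.
apply: leq_trans (_ : _ <= (size (mk_monic ('X^M : {poly U}))).-1)%N _.
  by rewrite -ltnS prednK ?size_mk_monic_gt0 // size_mk_monic.
by rewrite mk_monic_Xn_gt0 size_polyXn.
Qed.

Lemma coef_trunc_default (t : T) k : (M <= k)%N -> (t : {poly U})`_k = 0.
Proof. by move=> le_Mk; rewrite nth_default // (leq_trans (size_trunc t)). Qed.

Lemma tpolyK (t : T) : trunc t = t.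
Proof. by apply/val_inj/in_qpoly_small; rewrite size_mk_monic. Qed.

Lemma coef_tmul (t u : T) k : (k < M)%N ->
  (t * u : T)`_k = ((t : {poly U}) * (u : {poly U}))`_k.
Proof. by move=> ltk; rewrite -[t * u]/(trunc (_ * _)) coef_trunc ltk. Qed.

Lemma coef_tD (t u : T) k : (t + u : T)`_k = t`_k + u`_k.
Proof. exact: coefD. Qed.

Lemma coef_tB (t u : T) k : (t - u : T)`_k = t`_k - u`_k.
Proof. by rewrite (raddfB (@qpoly.polyn U _)) coefB. Qed.

Lemma coef_t1 k : (1 : T)`_k = (k == 0)%:R.
Proof. exact: coef1. Qed.

Lemma coef_t0 k : (0 : T)`_k = 0.
Proof. exact: coef0. Qed.

Lemma coef0_tmul (t u : T) : (t * u : T)`_0 = t`_0 * u`_0.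
Proof. by rewrite coef_tmul // coef0M. Qed.

(** Without constant term, [t] is a multiple of [y], so [t^M] is a multiple of [y^M]. *)
Lemma tpoly_nilp (t : T) : t`_0 = 0 -> t ^+ M = 0.
Proof.
move=> t0; rewrite -[t]tpolyK -rmorphXn /=.
have -> : (t : {poly U}) = (\poly_(i < M) t`_i.+1) * 'X.
  apply/polyP=> -[|k]; rewrite coefMX //= coef_poly; case: ltnP => // le_Mk.
  by rewrite coef_trunc_default // leqW.
rewrite exprMn rmorphM /= [X in _ * X](_ : _ = 0) ?mulr0 //.
apply/val_inj/polyP=> k; rewrite coef_trunc coefXn [RHS](coef0 _ k).
by case: ltnP => // ltk; rewrite ltn_eqF.
Qed.

(** The inverse of [1 - z] when [z] has no constant term: the geometric series stops because
    [z^M = 0]. *)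
Definition geom (z : T) : T := \sum_(i < M) z ^+ i.

Lemma mul_geom (z : T) : z`_0 = 0 -> (1 - z) * geom z = 1.
Proof.
move=> z0; have := subrX1 z M; rewrite tpoly_nilp // => E.
by rewrite -opprB mulNr -E sub0r opprK.
Qed.

(* One step of Gaussian elimination with pivot [S 0 0], on the trailing
   submatrix; [geom (1 - S 0 0)] is the inverse of the pivot. *)
Definition gauss_step (S : nat -> nat -> T) i j : T :=
  S i.+1 j.+1 - S i.+1 0%N * geom (1 - S 0%N 0%N) * S 0%N j.+1.

(** Identity modulo [y]. Pivots then have constant term 1 and are inverted by [geom]; elimination
    keeps the property, as its corrections are multiples of [y]. *)
Definition near_id (S : nat -> nat -> T) := forall i j, (S i j)`_0 = (i == j)%:R.

Lemma near_id_gauss S : near_id S -> near_id (gauss_step S).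
Proof.
move=> hS i j; rewrite /gauss_step coef_tB !coef0_tmul !hS.
by rewrite eqSS mul0r mul0r subr0.
Qed.

(** Arrays are indexed by [nat], so that elimination shifts indices without changing types; a matrix
    is cut out only to take determinants. *)
Definition lead k (S : nat -> nat -> T) := \matrix_(i < k, j < k) S i j.

Lemma det_gauss S k : near_id S ->
  \det (lead k.+1 S) = S 0%N 0%N * \det (lead k (gauss_step S)).
Proof.
move=> hS; have z0 : (1 - S 0%N 0%N : T)`_0 = 0.
  by rewrite coef_tB coef_t1 hS subrr.
pose B : 'rV[T]_k := \row_j S 0%N j.+1; pose C : 'cV[T]_k := \col_i S i.+1 0%N.
pose D : 'M[T]_k := \matrix_(i, j) S i.+1 j.+1.
have -> : lead k.+1 S = block_mx (S 0%N 0%N)%:M B C D :> 'M_(1 + k).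
  apply/matrixP=> i j; rewrite !mxE.
  case: splitP => i' Ei; rewrite !mxE; case: splitP => j' Ej; rewrite !mxE Ei Ej ?ord1 //.
rewrite [LHS](@det_schur _ 1 k _ (geom (1 - S 0%N 0%N))%:M); last first.
  by rewrite -scalar_mxM -{1}[S 0%N 0%N](subKr 1) mul_geom.
rewrite det_scalar1; congr (_ * \det _); apply/matrixP=> i j.
by rewrite mul_mx_scalar -scalemxAl !mxE big_ord1 !mxE mulrCA mulrA.
Qed.

Lemma det_gauss_prod S k : near_id S ->
  \det (lead k S) = \prod_(t < k) iter t gauss_step S 0%N 0%N.
Proof.
elim: k S => [|k IH] S hS; first by rewrite det_mx00 big_ord0.
rewrite det_gauss // big_ord_recl /= IH; last exact: near_id_gauss.
by congr (_ * _); apply: eq_bigr => t _; rewrite -iterSr.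
Qed.

End TruncatedPoly.

Arguments gauss_step {U M}.

Definition mul_const := (18 ^ 4)%N.

(** * Cost of arithmetic and elimination on truncated series *)

Section TruncatedDerivation.
Variables (U : comNzRingType) (s : nat).
Hypothesis s_gt0 : (0 < s)%N.
Local Notation M := (s * s)%N.
Local Notation T := {poly %/ ('X^M : {poly U})}.
Local Notation mu := mul_const.

Let M_gt0 : (0 < M)%N. Proof. by rewrite muln_gt0 s_gt0. Qed.

Lemma derives_coefs X c (t : T) : X 0 ->
  (forall k : 'I_M, derives X c (fun Z => Z t`_k)) ->
  derives X (M * c) (fun Z => polyin Z t).
Proof.
move=> X0 h; rewrite -{1}[M]card_ord.
apply: derives_imp (derives_all h) => Z sXZ hZ k.
have [ltk|lek] := ltnP k M; first exact: (hZ (Ordinal ltk)).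
by rewrite coef_trunc_default //; apply: sXZ.
Qed.

Lemma derives_tadd X (t u : T) : X 0 -> polyin X t -> polyin X u ->
  derives X M (fun Z => polyin Z (t + u : T)).
Proof.
move=> X0 Xt Xu; rewrite -[M in derives _ M]muln1.
by apply: derives_coefs => // k; rewrite coef_tD; apply: derives_add.
Qed.

Lemma derives_tsub X (t u : T) : X 0 -> polyin X t -> polyin X u ->
  derives X M (fun Z => polyin Z (t - u : T)).
Proof.
move=> X0 Xt Xu; rewrite -[M in derives _ M]muln1.
by apply: derives_coefs => // k; rewrite coef_tB //; apply: derives_sub.
Qed.

Lemma derives_tmul X (t u : T) : X 0 -> polyin X t -> polyin X u ->
  derives X (mu * s ^ 3) (fun Z => polyin Z (t * u : T)).
Proof.
move=> X0 Xt Xu.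
have := derives_mul_poly s_gt0 X0 Xt Xu (size_trunc M_gt0 t) (size_trunc M_gt0 u).
apply: derives_imp => Z sXZ hZ k.
have [ltk|lek] := ltnP k M; last by rewrite coef_trunc_default //; apply: sXZ.
by rewrite coef_tmul //; apply: (hZ (Ordinal ltk)).
Qed.

Lemma polyin1 (X : U -> Prop) : X 0 -> X 1 -> polyin X (1 : T).
Proof. by move=> X0 X1 k; rewrite coef_t1; case: (k == _). Qed.

(** Horner's rule, with [s^2] products of cost [O(s^3)]. Over the [s] pivots of one block this adds
    up to [O(s^6)]. *)
Lemma derives_geom X (z : T) : X 0 -> X 1 -> polyin X z ->
  derives X (2 * mu * s ^ 5) (fun Z => polyin Z (geom z)).
Proof.
move=> X0 X1 Xz.
pose x k : T := \sum_(i < k) z ^+ i.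
apply: (@derives_le _ _ (M * (mu * s ^ 3 + M))); last by rewrite /mul_const; nia.
apply: (@derives_iter _ _ _ _ (fun k Z => polyin Z (x k))).
- by move=> k; rewrite /x big_ord0 coef_t0.
- move=> k Y _ sXY hY.
  apply: derives_bind (derives_tmul (sXY _ X0) (fun i => sXY _ (Xz i)) hY) _.
  move=> Y' sYY' hY'; have -> : x k.+1 = 1 + z * x k.
    rewrite /x big_ord_recl mulr_sumr expr0; congr (_ + _).
    by apply: eq_bigr => i _; rewrite exprS.
  by apply: derives_tadd => //; [|apply: polyin1]; apply/sYY'/sXY.
by move=> k Y Z sYZ hY i; apply: sYZ.
Qed.

Lemma derives_prod n X (F : nat -> T) : X 0 -> X 1 ->
  (forall i, (i < n)%N -> polyin X (F i)) ->
  derives X (n * (mu * s ^ 3)) (fun Z => polyin Z (\prod_(i < n) F i)).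
Proof.
move=> X0 X1 XF.
apply: (@derives_iter _ _ _ _ (fun k Z => polyin Z (\prod_(i < k) F i))).
- by rewrite big_ord0; apply: polyin1.
- move=> k Y lt_kn sXY hY; rewrite big_ord_recr /=.
  by apply: derives_tmul => // [|i]; apply: sXY => //; apply: XF.
by move=> k Y Z sYZ hY i; apply: sYZ.
Qed.

Definition arrin n (Z : U -> Prop) (S : nat -> nat -> T) :=
  forall i j, (i < n)%N -> (j < n)%N -> polyin Z (S i j).

(** Inverting the pivot and updating at most [s^2] entries, with two products each, both cost
    [O(s^5)]. *)
Lemma derives_gauss n X (S : nat -> nat -> T) : X 0 -> X 1 ->
  (n < s)%N -> arrin n.+1 X S ->
  derives X (7 * mu * s ^ 5) (fun Z => arrin n Z (gauss_step S)).
Proof.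
move=> X0 X1 lt_ns XS.
apply: (@derives_le _ _
  (M + (2 * mu * s ^ 5 + n * n * (mu * s ^ 3 + (mu * s ^ 3 + M))))); last first.
  have le_nn : (n * n <= s * s)%N by rewrite leq_mul // ltnW.
  have s25 : (s ^ 2 <= s ^ 5)%N by rewrite leq_pexp2l.
  have s45 : (s ^ 4 <= s ^ 5)%N by rewrite leq_pexp2l.
  have := leq_mul le_nn (leqnn (mu * s ^ 3 + (mu * s ^ 3 + M))).
  by rewrite /mul_const; lia.
apply: derives_bind (derives_tsub X0 (polyin1 X0 X1) (XS 0%N 0%N _ _)) _ => // X2 s2 h2.
apply: derives_bind (derives_geom (s2 _ X0) (s2 _ X1) h2) _ => X3 s3 h3.
have sX3 := incl_trans s2 s3.
apply: (@derives_imp _ _ _ (fun Z => forall i j : 'I_n, polyin Z (gauss_step S i j))).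
  by move=> Z _ h i j lti ltj; apply: (h (Ordinal lti) (Ordinal ltj)).
rewrite -[X in (X * _ * _)%N](card_ord n) -[X in (_ * X * _)%N](card_ord n).
apply: derives_all2 => i j.
apply: derives_bind (derives_tmul (t := S i.+1 0%N) (sX3 _ X0) _ h3) _.
  by move=> k; apply/sX3; apply: XS; rewrite ?ltnS.
move=> X4 s4 h4.
apply: derives_bind (derives_tmul (u := S 0%N j.+1) (s4 _ (sX3 _ X0)) h4 _) _.
  by move=> k; apply/s4/sX3; apply: XS; rewrite ?ltnS.
move=> X5 s5 h5; apply: derives_tsub => //; first by apply/s5/s4/sX3.
by move=> k; apply/s5/s4/sX3; apply: XS; rewrite ltnS.
Qed.

Lemma derives_det X (S : nat -> nat -> T) : X 0 -> X 1 ->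
  near_id S -> arrin s X S ->
  derives X (8 * mu * s ^ 6) (fun Z => polyin Z (\det (lead s S))).
Proof.
move=> X0 X1 nS XS; rewrite det_gauss_prod //.
(* Invariant after [k] steps: the first [k] pivots are kept for the final product, and the trailing
   block of size [s - k] is known. *)
pose Phi k Z := [/\ incl X Z, forall t, (t < k)%N -> polyin Z (iter t gauss_step S 0%N 0%N)
  & arrin (s - k) Z (iter k gauss_step S)].
apply: (@derives_le _ _ (s * (7 * mu * s ^ 5) + s * (mu * s ^ 3))); last first.
  by rewrite /mul_const; nia.
apply: derives_bind (@derives_iter _ s X _ Phi _ _ _) _.
- by split=> //; rewrite subn0.
- move=> k Y lt_ks sXY [_ h1 h2].
  have E : (s - k = (s - k.+1).+1)%N by lia.
  have := @derives_gauss (s - k.+1) Y (iter k gauss_step S) (sXY _ X0) (sXY _ X1).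
  rewrite -E => /(_ _ h2) h; apply: derives_imp (h _); last by lia.
  move=> Z sYZ hZ; split=> //; first exact: incl_trans sYZ.
  move=> t; rewrite ltnS leq_eqVlt => /predU1P[->|ltt] i; apply: sYZ; last exact: h1.
  by apply: h2; lia.
- move=> k Y Z sYZ [h1 h2 h3]; split; first exact: incl_trans sYZ.
    by move=> t ltt i; apply/sYZ/h2.
  by move=> i j lti ltj u; apply/sYZ/h3.
move=> Y sXY [_ hY _].
exact: (@derives_prod s Y (fun t => iter t gauss_step S 0%N 0%N) (sXY _ X0) (sXY _ X1)).
Qed.

End TruncatedDerivation.

(** * The reversed characteristic polynomial *)

Section Krylov.
Variable U : comNzRingType.
Implicit Types (X Y Z : U -> Prop).

Lemma derives_exp2 X k (A : 'M[U]_k) e : X 0 -> mxin X A ->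
  derives X (e * (k * k * (2 * k))) (fun Z => mxin Z (A ^+ (2 ^ e))).
Proof.
move=> X0 XA.
apply: (@derives_iter _ _ _ _ (fun i Z => mxin Z (A ^+ (2 ^ i)))).
- by rewrite expn0 expr1.
- move=> i Y _ sXY hY; rewrite (_ : A ^+ _ = A ^+ (2 ^ i) *m A ^+ (2 ^ i)).
    by apply: derives_mulmx => //; apply: sXY.
  by rewrite expnS mul2n -addnn exprD.
by move=> i Y Z sYZ; apply: mxin_incl.
Qed.

Lemma derives_krylov_left X m k (V : 'M[U]_(m, k)) (A : 'M[U]_k) n :
  X 0 -> mxin X V -> mxin X A ->
  derives X (n * (m * k * (2 * k)))
    (fun Z => forall i, (i <= n)%N -> mxin Z (V *m A ^+ i)).
Proof.
move=> X0 XV XA; apply: (@derives_iter _ _ _ _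
  (fun n Z => forall i, (i <= n)%N -> mxin Z (V *m A ^+ i))).
- by move=> i; rewrite leqn0 => /eqP ->; rewrite expr0 mulmx1.
- move=> i Y _ sXY hY.
  apply: derives_imp (derives_mulmx (sXY _ X0) (hY i (leqnn _)) (mxin_incl sXY XA)).
  have -> : V *m A ^+ i *m A = V *m A ^+ i.+1 by rewrite exprSr mulmxA.
  move=> Z sYZ hZ j.
  by rewrite leq_eqVlt => /predU1P[->//|/hY]; apply: mxin_incl.
by move=> i Y Z sYZ hY j /hY; apply: mxin_incl.
Qed.

Lemma derives_krylov_right X m k (W : 'M[U]_(k, m)) (A : 'M[U]_k) n :
  X 0 -> mxin X W -> mxin X A ->
  derives X (n * (k * m * (2 * k)))
    (fun Z => forall i, (i <= n)%N -> mxin Z (A ^+ i *m W)).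
Proof.
move=> X0 XW XA; apply: (@derives_iter _ _ _ _
  (fun n Z => forall i, (i <= n)%N -> mxin Z (A ^+ i *m W))).
- by move=> i; rewrite leqn0 => /eqP ->; rewrite expr0 mul1mx.
- move=> i Y _ sXY hY.
  apply: derives_imp (derives_mulmx (sXY _ X0) (mxin_incl sXY XA) (hY i (leqnn _))).
  have -> : A *m (A ^+ i *m W) = A ^+ i.+1 *m W by rewrite exprS mulmxA.
  move=> Z sYZ hZ j.
  by rewrite leq_eqVlt => /predU1P[->//|/hY]; apply: mxin_incl.
by move=> i Y Z sYZ hY j /hY; apply: mxin_incl.
Qed.

(** Baby and giant steps with [l = i + s j]. Since [k <= s^2], the left products, the right products
    and their pairings cost at most [2 * s^6] each, and the repeated squaring [2 * e * s^6]. *)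
Lemma derives_moments X e k (V : 'M[U]_(2 ^ e, k)) (A : 'M[U]_k) (W : 'M[U]_(k, 2 ^ e)) :
  let s := (2 ^ e)%N in
  X 0 -> (k <= s * s)%N -> mxin X V -> mxin X A -> mxin X W ->
  derives X ((2 * e + 6) * s ^ 6)
    (fun Z => forall l, (l < s * s)%N -> mxin Z (V *m A ^+ l *m W)).
Proof.
move=> s X0 le_k XV XA XW.
have s0 : (0 < s)%N by rewrite expn_gt0.
have kk : (k * k <= s ^ 4)%N.
  by apply: leq_trans (leq_mul le_k le_k) _; lia.
have skk : (s * k * (2 * k) <= 2 * s ^ 5)%N.
  by have := leq_mul (leqnn (2 * s)) kk; lia.
have kkk : (k * k * (2 * k) <= 2 * s ^ 6)%N.
  by have := leq_mul (leqnn 2) (leq_mul kk le_k); lia.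
have ssk : (s * s * (s * s * (2 * k)) <= 2 * s ^ 6)%N.
  by have := leq_mul (leqnn (2 * s ^ 4)) le_k; lia.
apply: (@derives_le _ _ (e * (k * k * (2 * k)) + (s * (s * k * (2 * k)) +
   (s * (k * s * (2 * k)) + s * s * (s * s * (2 * k)))))); last first.
  have := leq_mul (leqnn e) kkk; have := leq_mul (leqnn s) skk.
  by rewrite [(k * s)%N]mulnC; lia.
apply: derives_bind (derives_exp2 e X0 XA) _ => X1 s1 h1.
apply: derives_bind (derives_krylov_left s (s1 _ X0) (mxin_incl s1 XV) (mxin_incl s1 XA)) _.
move=> X2 s2 h2; have sX2 := incl_trans s1 s2.
apply: derives_bind (derives_krylov_right s (sX2 _ X0) (mxin_incl sX2 XW) (mxin_incl s2 h1)) _.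
move=> X3 s3 h3.
apply: (@derives_imp _ _ _ (fun Z => forall i j : 'I_s,
    mxin Z (V *m A ^+ i *m ((A ^+ s) ^+ j *m W)))).
  move=> Z _ hZ l ltl.
  have ltd : (l %/ s < s)%N by rewrite ltn_divLR.
  have ltm : (l %% s < s)%N by rewrite ltn_mod.
  have := hZ (Ordinal ltm) (Ordinal ltd) => /=.
  rewrite mulmxA -(mulmxA V) -exprM.
  have -> : A ^+ (l %% s) *m A ^+ (s * (l %/ s)) = A ^+ l => //.
  by rewrite [in RHS](divn_eq l s) addnC mulnC exprD.
rewrite -[X in (X * _ * _)%N](card_ord s) -[X in (_ * X * _)%N](card_ord s).
apply: derives_all2 => i j; apply: derives_mulmx; first exact/s3/sX2.
  by apply: mxin_incl s3 _; apply: h2; apply: ltnW.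
by apply: h3; apply: ltnW.
Qed.

End Krylov.

Lemma expr_scalemx (R : comNzRingType) k (c : R) (A : 'M_k) n :
  (c *: A) ^+ n = c ^+ n *: A ^+ n.
Proof.
elim: n => [|n IH]; first by rewrite !expr0 scale1r.
by rewrite !exprS IH -!mulmxE -scalemxAl -scalemxAr scalerA.
Qed.

Lemma map_mx_exp (R S : comNzRingType) (f : {rmorphism R -> S}) k (A : 'M_k) n :
  map_mx f (A ^+ n) = map_mx f A ^+ n.
Proof.
elim: n => [|n IH]; first exact: map_mx1.
by rewrite !exprS -!mulmxE map_mxM IH.
Qed.

(** * Bordering the leading submatrices of [1 - yA] *)

Section BlockSchur.
Variables (U : comNzRingType) (M : nat).
Hypothesis M_gt0 : (0 < M)%N.
Variable a : nat -> nat -> U.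

Local Notation T := {poly %/ ('X^M : {poly U})}.
Local Notation trunc := (in_qpoly ('X^M : {poly U})).
Local Notation y := (trunc 'X).
Local Notation cst := (trunc \o polyC).

Definition blk i0 j0 m n : 'M[U]_(m, n) := \matrix_(i, j) a (i0 + i) (j0 + j).

Definition rev_char k : T := \det (1%:M - y *: map_mx cst (blk 0 0 k k)).

(** The entry [(i, j)] of [C A_k^l B], written with one row and one column so that no block width
    enters; [momentE] links it to the block product. *)
Definition moment k l i j : U :=
  (blk (k + i) 0 1 k *m blk 0 0 k k ^+ l *m blk 0 (k + j) k 1) 0 0.

(* Since [y^M = 0], this is [D - C P^-1 B] for the block decomposition of
   [1 - y A_(k+s)] with upper left block [P = 1 - y A_k]. *)
Definition schur k i j : T :=
  trunc ((i == j)%:R - a (k + i) (k + j) *: 'X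
         - \sum_(l < M) moment k l i j *: 'X^(l.+2)).

Lemma momentE k l s (i j : 'I_s) :
  (blk k 0 s k *m blk 0 0 k k ^+ l *m blk 0 k k s) i j = moment k l i j.
Proof.
rewrite /moment !mxE; apply: eq_bigr => u _; rewrite !mxE addn0; congr (_ * _).
by apply: eq_bigr => v _; rewrite !mxE addn0.
Qed.

(** The form [0 - _] corresponds to a single subtraction, as there is no negation instruction. *)
Lemma coef_schur k i j t : (t < M)%N -> (schur k i j)`_t =
  if t is t'.+1 then
    if t' is l.+1 then 0 - moment k l i j else 0 - a (k + i) (k + j)
  else (i == j)%:R.
Proof.
move=> ltt; rewrite coef_trunc // ltt !coefB coefZ coefX coef_sum -polyC_natr coefC.
case: t ltt => [|[|l]] ltt /=.
- by rewrite mulr0 big1 ?subr0 // => l _; rewrite coefZ coefXn mulr0.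
- by rewrite mulr1 big1 ?subr0 // => l _; rewrite coefZ coefXn mulr0.
have ltl : (l < M)%N by lia.
rewrite mulr0 subr0 (bigD1 (Ordinal ltl)) //= coefZ coefXn eqxx mulr1.
rewrite big1 ?addr0 // => l'; rewrite -val_eqE /= => nel.
by rewrite coefZ coefXn !eqSS eq_sym (negbTE nel) mulr0.
Qed.

Lemma near_id_schur k : near_id (schur k).
Proof. by move=> i j; rewrite coef_schur. Qed.

Lemma rev_charD k s : rev_char (k + s) = rev_char k * \det (lead s (schur k)).
Proof.
pose A := map_mx cst (blk 0 0 k k); pose B := map_mx cst (blk 0 k k s).
pose C := map_mx cst (blk k 0 s k); pose D := map_mx cst (blk k k s s).
have yM : y ^+ M = 0.
  by apply: tpoly_nilp => //; rewrite coef_trunc //; case: ifP => // _; apply: coefX.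
(* As [y^M = 0], the finite Neumann series inverts [1 - yA]. *)
have PQ : (1%:M - y *: A) *m (\sum_(l < M) (y *: A) ^+ l) = 1%:M.
  have := subrX1 (y *: A) M; rewrite expr_scalemx yM scale0r sub0r => E.
  by apply: oppr_inj; rewrite -mulNmx opprB; apply: esym E.
have -> : rev_char (k + s) =
    \det (block_mx (1%:M - y *: A) (- (y *: B)) (- (y *: C)) (1%:M - y *: D)).
  congr (\det _); apply/matrixP=> i j; rewrite !mxE.
  case: splitP => i' Ei; rewrite !mxE; case: splitP => j' Ej; rewrite !mxE Ei Ej //.
  - by rewrite -!val_eqE /= Ei Ej !add0n.
  - by rewrite -!val_eqE /= Ei Ej ltn_eqF ?sub0r ?add0n // ltn_addr.
  - by rewrite -!val_eqE /= Ei Ej gtn_eqF ?sub0r ?add0n // ltn_addr.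
  by rewrite -!val_eqE /= Ei Ej eqn_add2l.
rewrite (det_schur _ _ _ PQ); congr (_ * \det _); apply/matrixP=> i j.
have CB l : (C *m A ^+ l *m B) i j = cst (moment k l i j).
  by rewrite -(momentE _ _ i j) /C /A /B -map_mx_exp -!map_mxM [in LHS]mxE.
(* The signs of the two off-diagonal blocks cancel, and their two factors [y] turn [y^l] into
   [y^(l+2)]. *)
rewrite !mulNmx mulmxN opprK mulmx_sumr mulmx_suml !mxE summxE.
rewrite /schur !rmorphB /= rmorph_nat rmorph_sum; congr (_ - _ - _).
  by rewrite -mul_polyC rmorphM mulrC.
apply: eq_bigr => l _; rewrite expr_scalemx.
rewrite -!(scalemxAl, scalemxAr) !scalerA mxE CB -mul_polyC rmorphM /= mulrC.
by rewrite rmorphXn !exprS -!mulrA.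
Qed.

End BlockSchur.

Section RevCharDerivation.
Variables (U : comNzRingType) (e : nat) (a : nat -> nat -> U).
Local Notation s := (2 ^ e)%N.
Local Notation M := (s * s)%N.
Local Notation mu := mul_const.
Local Notation T := {poly %/ ('X^M : {poly U})}.

Let s_gt0 : (0 < s)%N. Proof. by rewrite expn_gt0. Qed.
Let M_gt0 : (0 < M)%N. Proof. by rewrite muln_gt0 s_gt0. Qed.

Lemma derives_schur X k : X 0 -> X 1 -> (forall i j, X (a i j)) -> (k <= M)%N ->
  derives X ((2 * e + 7) * s ^ 6) (fun Z => arrin s Z (schur M a k)).
Proof.
move=> X0 X1 Xa le_k.
have Xblk i0 j0 m n : mxin X (blk a i0 j0 m n) by move=> i j; rewrite mxE.
apply: (@derives_le _ _ ((2 * e + 6) * s ^ 6 + s * s * (M * 1))); last first.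
  have : (s ^ 4 <= s ^ 6)%N by rewrite leq_pexp2l.
  by lia.
apply: derives_bind (derives_moments X0 le_k (Xblk k 0 s k)%N (Xblk 0 0 k k)%N
  (Xblk 0 k k s)%N) _ => Y sXY hY.
apply: (@derives_imp _ _ _ (fun Z => forall i j : 'I_s, polyin Z (schur M a k i j))).
  by move=> Z _ h i j lti ltj; apply: (h (Ordinal lti) (Ordinal ltj)).
rewrite -[X in (X * _ * _)%N](card_ord s) -[X in (_ * X * _)%N](card_ord s).
apply: derives_all2 => i j; apply: (derives_coefs s_gt0); first exact: sXY.
case=> t ltt; rewrite coef_schur //=; case: t ltt => [|[|l]] ltt.
- by case: (i == j :> nat); apply: derives_ret => Z sYZ;
    [apply: (sYZ _ (sXY _ X1)) | apply: (sYZ _ (sXY _ X0))].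
- by apply: derives_sub; [apply: sXY | apply/sXY/Xa].
apply: derives_sub; first exact: sXY.
by rewrite -(momentE a k l i j); apply: hY; lia.
Qed.

(** Starting from the empty determinant 1, [s] borderings by [s] rows and columns reach size [M].
    Each costs [O((e + 1) s^6)]. *)
Lemma derives_rev_char X : X 0 -> X 1 -> (forall i j, X (a i j)) ->
  derives X (10 * mu * (e + 1) * s ^ 7) (fun Z => polyin Z (rev_char M a M)).
Proof.
move=> X0 X1 Xa.
apply: (@derives_le _ _
  (s * ((2 * e + 7) * s ^ 6 + (8 * mu * s ^ 6 + mu * s ^ 3)))); last first.
  have : (s ^ 4 <= s ^ 7)%N by rewrite leq_pexp2l.
  have : (0 <= e * s ^ 7)%N by [].
  by rewrite /mul_const; lia.
apply: (@derives_iter _ s X _ (fun K Z => polyin Z (rev_char M a (K * s)))).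
- by rewrite /rev_char mul0n det_mx00; apply: polyin1.
- move=> K Y lt_Ks sXY hY; have -> : (K.+1 * s = K * s + s)%N by rewrite mulSn addnC.
  rewrite rev_charD //.
  apply: derives_bind (@derives_schur _ (K * s) (sXY _ X0) (sXY _ X1) _ _) _.
  + by move=> i j; apply: sXY.
  + by rewrite leq_mul // ltnW.
  move=> Y1 s1 h1; have sX1 := incl_trans sXY s1.
  apply: derives_bind (derives_det s_gt0 (sX1 _ X0) (sX1 _ X1) _ h1) _.
    exact: near_id_schur.
  move=> Y2 s2 h2; apply: derives_tmul => //; first exact/s2/sX1.
  by move=> i; apply/s2/s1.
by move=> K Y Z sYZ hY i; apply: sYZ.
Qed.

End RevCharDerivation.

(** * The adjugate matrix *)

Section Adjugate.
Variable U : comNzRingType.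

Lemma coef_prod_linear m (F : 'I_m -> {poly U}) :
  (forall i, size (F i) <= 2)%N -> (\prod_i F i)`_m = \prod_i (F i)`_1.
Proof.
move=> szF; suff [] : (size (\prod_i F i)%R <= m.+1)%N /\
  (\prod_i F i)`_m = \prod_i (F i)`_1 by [].
elim: m F szF => [|m IH] F szF.
  by rewrite !big_ord0 coef1 size_poly1.
have [szP EP] := IH (fun i => F (lift ord0 i)) (fun i => szF _).
rewrite !big_ord_recl; split.
  apply: leq_trans (size_polyMleq _ _) _; rewrite -subn1 leq_subLR.
  by apply: leq_trans (leq_add (szF _) szP) _.
rewrite coefM big_ord_recl big_ord_recl /= [X in _ + (_ + X)]big1 => [|i _].
  by rewrite addr0 subn0 [X in _ * X](nth_default _ szP) mulr0 add0r subn1 EP.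
by rewrite (nth_default _ (leq_trans (szF _) _)) ?mul0r.
Qed.

(** Applied to the minors of [1 - yA], this identifies the coefficient of degree [n - 1] of its
    adjugate with the adjugate of [-A]. *)
Lemma coef_det_linear m (D : 'M[{poly U}]_m) :
  (forall i j, size (D i j) <= 2)%N ->
  (\det D)`_m = \det (map_mx (coefp 1) D).
Proof.
move=> szD; rewrite /determinant coef_sum; apply: eq_bigr => sg _.
rewrite -signr_odd -polyC1 -polyCN -polyC_exp coefCM coef_prod_linear //.
by rewrite signr_odd; congr (_ * _); apply: eq_bigr => i _; rewrite mxE.
Qed.

Definition revdet n (A : 'M[U]_n) : {poly U} :=
  \det (1%:M - 'X *: map_mx polyC A).

(* Compare coefficients of degree [n - 1] in
   [adj (1 - yA) (1 - y^n A^n) = q sum_(k < n) y^k A^k]. *)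
Lemma adj_revdet n (A : 'M[U]_n) :
  \adj A = \sum_(k < n) ((-1) ^+ n.-1 * (revdet A)`_(n.-1 - k)) *: A ^+ k.
Proof.
case: n A => [|n] A; first by apply/matrixP=> -[].
set P := 1%:M - 'X *: map_mx polyC A.
pose G := \sum_(k < n.+1) ('X *: map_mx polyC A) ^+ k.
have PG : P *m G = 1%:M - 'X^(n.+1) *: map_mx polyC (A ^+ n.+1).
  apply: oppr_inj; rewrite -mulNmx !opprB map_mx_exp -expr_scalemx.
  exact: esym (subrX1 _ _).
have adjPG : \adj P - 'X^(n.+1) *: (\adj P *m map_mx polyC (A ^+ n.+1))
    = revdet A *: G.
  by rewrite -[RHS]mul_scalar_mx /revdet -/P -mul_adj_mx -mulmxA PG mulmxBr mulmx1 scalemxAr.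
have adjP i j : (\adj P i j)`_n = \adj (-1 *: A) i j.
  rewrite !mxE /cofactor -signr_odd -polyC1 -polyCN -polyC_exp coefCM signr_odd.
  congr (_ * _); rewrite coef_det_linear => [|i' j'].
    congr (\det _); apply/matrixP=> i' j'; rewrite !mxE /=.
    by rewrite coefB coefXM mulN1r coefC /= -polyC_natr coefC sub0r.
  rewrite !mxE; apply: leq_trans (size_polyD _ _) _.
  rewrite geq_max size_polyN -polyC_natr (leq_trans (size_polyC_leq1 _)) //.
  apply: leq_trans (size_polyMleq _ _) _.
  by rewrite size_polyX size_polyC; case: (_ != 0).
apply/matrixP=> i j.
have -> : \adj A i j = (-1) ^+ n * (\adj P i j)`_n.
  by rewrite adjP adjZ [in RHS]mxE mulrA -exprMn mulrNN mulr1 expr1n mul1r.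
have -> : (\adj P i j)`_n = ((revdet A *: G) i j)`_n.
  (* The correction term is a multiple of ['X^(n.+1)], hence has no coefficient of degree [n]. *)
  rewrite -adjPG; move: (\adj P *m _) => Q'; move: (\adj P) => Q.
  by rewrite !mxE coefB coefXnM ltnSn subr0.
rewrite [in LHS]mxE /G summxE mulr_sumr coef_sum mulr_sumr summxE; apply: eq_bigr => k _ /=.
rewrite expr_scalemx -map_mx_exp !mxE mulrCA coefXnM ltnNge -ltnS ltn_ord /=.
by rewrite coefMC mulrA.
Qed.

End Adjugate.

(** * Evaluating a polynomial at a matrix *)

Section MatrixPoly.
Variables (U : comNzRingType) (s n : nat).
Hypotheses (s_gt0 : (0 < s)%N) (le_n : (n <= s * s)%N).

(** Paterson-Stockmeyer: [s] products for the powers up to [A^s] and [s] more for Horner's rule,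
    each costing at most [2 * s^6]. The blocks [D b] need only scalar multiples, [O(s^6)] in all. *)
Lemma derives_mxpoly (X : U -> Prop) (A : 'M[U]_n) (w : nat -> U) :
  X 0 -> X 1 -> mxin X A -> (forall j, X (w j)) ->
  derives X (10 * s ^ 7) (fun Z => mxin Z (\sum_(j < s * s) w j *: A ^+ j)).
Proof.
move=> X0 X1 XA Xw.
have nn : (n * n <= s ^ 4)%N.
  by apply: leq_trans (leq_mul le_n le_n) _; lia.
have nnn : (n * n * (2 * n) <= 2 * s ^ 6)%N.
  by have := leq_mul (leqnn 2) (leq_mul nn le_n); lia.
apply: (@derives_le _ _ (s * (n * n * (2 * n)) +
  (s * (n * n * (2 * s)) + s * (n * n * (2 * n) + n * n)))); last first.
  have s67 : (s ^ 6 <= s ^ 7)%N by rewrite leq_pexp2l.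
  have s57 : (s ^ 5 <= s ^ 7)%N by rewrite leq_pexp2l.
  have := leq_mul (leqnn s) nnn; have := leq_mul (leqnn (s * (2 * s))) nn.
  by have := leq_mul (leqnn s) nn; lia.
have X1m : mxin X (1%:M : 'M[U]_n).
  by move=> i j; rewrite mxE; case: (i == j).
apply: derives_bind (derives_krylov_left s X0 X1m XA) _ => X2 s2 h2.
pose D b : 'M[U]_n := \sum_(j < s) w (s * b + j)%N *: A ^+ j.
apply: (derives_bind (Phi := fun Z => forall b : 'I_s, mxin Z (D b))).
  rewrite -[X in (X * _)%N](card_ord s); apply: derives_all => b.
  rewrite -[X in (X * _ * _)%N](card_ord n) -[X in (_ * X * _)%N](card_ord n).
  apply: derives_all2 => i j; rewrite summxE.
  rewrite (eq_bigr (fun k : 'I_s => w (s * b + k)%N * (1%:M *m A ^+ k) i j)).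
    rewrite -[X in (_ * X)%N](card_ord s); apply: derives_dot => [|k|k].
    - exact: s2.
    - exact/s2/Xw.
    by apply: h2; apply: ltnW.
  by move=> k _; rewrite mul1mx mxE.
move=> X3 s3 h3; have sX3 := incl_trans s2 s3.
(* Horner's rule in [A ^+ s]: [H i] collects the top [i] blocks of coefficients. *)
pose H i : 'M[U]_n := \sum_(j < s * i) w (s * (s - i) + j)%N *: A ^+ j.
have HS i : (i < s)%N -> H i.+1 = D (s - i.+1)%N + A ^+ s *m H i.
  move=> lt_is; rewrite /H mulnS big_split_ord /=; congr (_ + _).
  rewrite mulmx_sumr; apply: eq_bigr => j _; rewrite exprD -scalemxAr.
  by congr (w _ *: _); rewrite addnA -mulnSr subnSK.
rewrite (_ : \sum_(j < _) _ = H s); last by rewrite /H subnn muln0.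
apply: (@derives_iter _ s X3 _ (fun i Z => mxin Z (H i))).
- by move=> i j; rewrite /H muln0 big_ord0 mxE; apply: sX3.
- move=> i Y lt_is sXY hY; rewrite HS //.
  have h2s : mxin X2 (A ^+ s) by rewrite -[A ^+ s]mul1mx; apply: h2.
  apply: derives_bind (derives_mulmx (sXY _ (sX3 _ X0)) (mxin_incl (incl_trans s3 sXY) h2s) hY) _.
  move=> Y1 s1 h1; apply: derives_addmx => //.
  have lt_b : (s - i.+1 < s)%N by lia.
  by apply: mxin_incl s1 _; apply: mxin_incl sXY _; apply: (h3 (Ordinal lt_b)).
by move=> i Y Z sYZ; apply: mxin_incl.
Qed.

End MatrixPoly.

Section Padding.
Variables (U : comNzRingType) (M n : nat) (A : 'M[U]_n).
Hypothesis M_gt0 : (0 < M)%N.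

Definition pad (i j : nat) : U :=
  if (insub i, insub j) is (Some i', Some j') then A i' j' else 0.

Lemma padE (i j : 'I_n) : pad i j = A i j.
Proof. by rewrite /pad !valK. Qed.

Lemma pad_eq0 i j : (n <= maxn i j)%N -> pad i j = 0.
Proof.
rewrite leq_max /pad => /orP[] h.
  by rewrite insubN // -leqNgt.
by case: (insub i) => // ?; rewrite insubN // -leqNgt.
Qed.

(** Zero padding turns [1 - yA] into a block diagonal matrix with an identity block, so the
    blockwise computation at size [s * s] serves every [n <= s * s]. *)
Lemma rev_char_pad m : rev_char M pad (n + m) = in_qpoly 'X^M (revdet A).
Proof.
rewrite /rev_char /revdet -det_map_mx.
set y := in_qpoly _ 'X; set B := map_mx _ (1%:M - _).
rewrite -[RHS]mulr1 -[X in _ * X](det1 _ m) -(det_lblock B 0).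
congr (\det _); apply/matrixP=> i j; rewrite !mxE.
case: splitP => i' Ei; rewrite !mxE; case: splitP => j' Ej; rewrite !mxE Ei Ej !add0n.
- rewrite padE rmorphB rmorphM rmorph_nat /=.
  by rewrite -!val_eqE /= Ei Ej.
- rewrite pad_eq0 ?leq_max ?leq_addr ?orbT // rmorph0 mulr0 subr0.
  by rewrite -val_eqE /= Ei Ej ltn_eqF // ltn_addr.
- rewrite pad_eq0 ?leq_max ?leq_addr ?orbT // rmorph0 mulr0 subr0.
  by rewrite -val_eqE /= Ei Ej gtn_eqF // ltn_addr.
rewrite pad_eq0 ?leq_max ?leq_addr ?orbT // rmorph0 mulr0 subr0.
by rewrite -!val_eqE /= Ei Ej eqn_add2l.
Qed.

End Padding.

Lemma derives_adj (U : comNzRingType) (X : U -> Prop) n e (A : 'M[U]_n) :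
  let s := (2 ^ e)%N in
  (n <= s * s)%N -> mxin X A ->
  derives X (11 * mul_const * (e + 1) * s ^ 7) (fun Z => mxin Z (\adj A)).
Proof.
move=> s le_n XA.
have s0 : (0 < s)%N by rewrite expn_gt0.
have M0 : (0 < s * s)%N by rewrite muln_gt0 s0.
apply: (@derives_le _ _ (1 + (1 + (10 * mul_const * (e + 1) * s ^ 7 +
  (1 + (s * s * 1 + 10 * s ^ 7)))))); last first.
  have s27 : (s ^ 2 <= s ^ 7)%N by rewrite leq_pexp2l.
  have s07 : (s ^ 0 <= s ^ 7)%N by rewrite leq_pexp2l.
  by rewrite /mul_const; lia.
apply: derives_bind (derives_const X 0) _ => X1 s1 h0.
apply: derives_bind (derives_const X1 1) _ => X2 s2 h1.
have sX2 := incl_trans s1 s2.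
have h0' : X2 0 by apply: s2.
have Xpad i j : X2 (pad A i j).
  by rewrite /pad; case: insub => // i'; case: insub => // j'; apply: sX2.
apply: derives_bind (derives_rev_char e h0' h1 Xpad) _ => X3 s3 h3.
apply: derives_bind (derives_const X3 ((-1) ^+ n.-1)) _ => X4 s4 h4.
have Erev : rev_char (s * s) (pad A) (s * s) = in_qpoly 'X^(s * s) (revdet A).
  by rewrite -[X in rev_char _ _ X](subnKC le_n) rev_char_pad.
(* The weights vanish from [n] on, so the sum can run up to [s * s]; without the test, truncated
   subtraction would return the coefficient of index 0. *)
pose w j : U := if (j < n)%N then (-1) ^+ n.-1 * (revdet A)`_(n.-1 - j) else 0.
have sX4 := incl_trans s3 s4.
apply: (derives_bind (Phi := fun Z => forall j : 'I_(s * s), Z (w j))).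
  rewrite -{1}[(s * s)%N]card_ord; apply: derives_all => j.
  rewrite /w; case: ifP => ltj; last by apply: derives_ret => Z; apply; apply: sX4.
  apply: derives_mul; first by rewrite rmorphXn rmorphN1 in h4.
  apply: s4; have := h3 (n.-1 - j)%N; rewrite Erev coef_trunc //.
  by rewrite ifT //; lia.
move=> X5 s5 h5; have sX5 := incl_trans sX4 s5.
have -> : \adj A = \sum_(j < s * s) w j *: A ^+ j.
  rewrite adj_revdet (big_ord_widen (s * s) (fun k =>
    ((-1) ^+ n.-1 * (revdet A)`_(n.-1 - k)) *: A ^+ k)) // big_mkcond /=.
  by apply: eq_bigr => k _; rewrite /w; case: ifP => // _; rewrite scale0r.
apply: derives_mxpoly => //.
- exact: sX5.
- exact: sX5.
- by move=> i j; apply/sX5/sX2.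
move=> j; have [ltj|lej] := ltnP j (s * s); first exact: (h5 (Ordinal ltj)).
by rewrite /w ltnNge (leq_trans le_n lej) /=; apply: sX5.
Qed.

(** * Straight-line programs *)

Lemma slp_wf_cons k c p : slp_wf k (c :: p) = instr_ok k c && slp_wf k.+1 p.
Proof.
rewrite /slp_wf /= addn0; congr (_ && _).
elim: p 0%N => //= d p IH m.
by rewrite addnS IH addSn.
Qed.

(** An available value is addressed by its first position in the list. *)
Lemma chain_slp (U : comNzRingType) (L inp : seq U) :
  chain (fun u => u \in inp) L ->
  exists p, [/\ size p = size L, slp_wf (size inp) p & slp_eval p inp = inp ++ L].
Proof.
elim: L inp => [|x L IH] inp /=; first by exists [::]; rewrite cats0.
case=> hx hL; have [|p [szp wfp evp]] := IH (rcons inp x).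
  by apply: chain_incl hL => u; rewrite mem_rcons inE => -[->|->]; rewrite ?eqxx ?orbT.
rewrite size_rcons in wfp; rewrite cat_rcons in evp.
suff [c okc stepc] : exists2 c, instr_ok (size inp) c & step inp c = rcons inp x.
  by exists (c :: p); rewrite /= szp slp_wf_cons okc wfp /slp_eval /= stepc.
case: hx => [[z ->]|[u [v [hu hv]]]]; first by exists (IConst z).
have ltu : (index u inp < size inp)%N by rewrite index_mem.
have ltv : (index v inp < size inp)%N by rewrite index_mem.
case=> ->.
- by exists (IAdd (index u inp) (index v inp));
    [rewrite /= ltu|rewrite /step !nth_index].
- by exists (ISub (index u inp) (index v inp));
    [rewrite /= ltu|rewrite /step !nth_index].
by exists (IMul (index u inp) (index v inp));
    [rewrite /= ltu|rewrite /step !nth_index].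
Qed.

(** Constants are integers and the default [0] of [nth] is preserved, so a computation on the
    generic matrix specializes to every ring. *)
Lemma slp_eval_rmorph (U R : comNzRingType) (f : {rmorphism U -> R}) p inp :
  slp_eval p (map f inp) = map f (slp_eval p inp).
Proof.
rewrite /slp_eval; elim: p inp => //= c p IH inp; rewrite -IH; congr (foldl _ _ _).
have fn i : nth 0 (map f inp) i = f (nth 0 inp i).
  have [lti|lei] := ltnP i (size inp); first by rewrite (nth_map 0).
  by rewrite !nth_default ?size_map // rmorph0.
rewrite /step map_rcons; congr (rcons _ _).
by case: c => [z|i j|i j|i j]; rewrite ?fn ?rmorph_int ?rmorphB ?rmorphD ?rmorphM.
Qed.

Lemma map_mx_entries (U R : comNzRingType) (f : {rmorphism U -> R}) n (A : 'M[U]_n) :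
  map f (mx_entries A) = mx_entries (map_mx f A).
Proof.
rewrite /mx_entries map_allpairs; apply: eq_allpairs => i j.
by rewrite mxE.
Qed.

Lemma size_mx_entries (R : comNzRingType) n (A : 'M[R]_n) :
  size (mx_entries A) = (n * n)%N.
Proof. by rewrite size_allpairs size_enum_ord. Qed.

(** * The generic matrix over the integers and its specializations *)

Section Generic.
Variable n : nat.
Local Notation U := {mpoly int[n * n]}.

Definition generic_mx : 'M[U]_n := \matrix_(i, j) 'X_(mxvec_index i j).

Lemma specialize_is_rmorphism (R : comNzRingType) (A : 'M[R]_n) :
  exists f : {rmorphism U -> R}, map_mx f generic_mx = A.
Proof.
pose f : {rmorphism U -> R} := mmap (intr : int -> R) (fun k => mxvec A 0 k).
exists f; apply/matrixP=> i j; rewrite !mxE.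
by rewrite /f /= mmapX mmap1U mxvecE.
Qed.

End Generic.

Lemma adj_slp_exists n e : (n <= 2 ^ e * 2 ^ e)%N ->
  exists P : seq instr * seq nat,
    [/\ slp_wf (n * n) P.1 /\ size P.2 = (n * n)%N /\
        all (fun o => (o < n * n + size P.1)%N) P.2,
      (forall (R : comNzRingType) (A : 'M[R]_n) (i j : 'I_n),
        nth 0 (slp_eval P.1 (mx_entries A)) (nth 0%N P.2 (i * n + j)) = \adj A i j) &
      (slp_cost P.1 <= 11 * mul_const * (e + 1) * (2 ^ e) ^ 7)%N].
Proof.
move=> le_n; pose G := generic_mx n; pose inp := mx_entries G.
have inG : mxin (fun u => u \in inp) G.
  by move=> i j; apply: allpairs_f; rewrite mem_enum.
have [L [szL chL hL]] := derives_adj le_n inG.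
have [p [szp wfp evp]] := chain_slp chL.
have adjin : mxin (fun u => u \in inp ++ L) (\adj G).
  by apply: hL => u uin; rewrite mem_cat uin ?orbT.
(* Decodes [k = i * n + j]; the default 0 does not occur for [k < n * n]. *)
pose val_at k := if insub (k %/ n)%N is Some i then
  if insub (k %% n)%N is Some j then index (\adj G i j) (inp ++ L) else 0%N else 0%N.
have val_atE (i j : 'I_n) : val_at (i * n + j)%N = index (\adj G i j) (inp ++ L).
  have n0 : (0 < n)%N by apply: leq_ltn_trans (ltn_ord i).
  by rewrite /val_at divnMDl // modnMDl divn_small // modn_small // addn0 !valK.
have szcat : size (inp ++ L) = (n * n + size L)%N by rewrite size_cat size_mx_entries.
exists (p, mkseq val_at (n * n)); split=> /=.
- rewrite size_mx_entries in wfp; split=> //; split; first by rewrite size_mkseq.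
  apply/allP=> o /mapP[k]; rewrite mem_iota add0n => /= ltk ->.
  have n0 : (0 < n)%N by nia.
  have ltd : (k %/ n < n)%N by rewrite ltn_divLR.
  have ltm : (k %% n < n)%N by rewrite ltn_mod.
  have -> : k = (Ordinal ltd * n + Ordinal ltm)%N by rewrite /= -divn_eq.
  by rewrite val_atE szp -szcat index_mem adjin.
- move=> R A i j; have [f fG] := specialize_is_rmorphism A.
  have ltk : (i * n + j < n * n)%N by have := ltn_ord i; have := ltn_ord j; nia.
  rewrite nth_mkseq // val_atE -fG -map_mx_entries slp_eval_rmorph evp.
  rewrite (nth_map 0) ?index_mem ?adjin // nth_index ?adjin //.
  by rewrite -map_mx_adj [in RHS]mxE.
by rewrite /slp_cost szp.
Qed.

(** Squaring expresses [n^3 sqrt n] in natural numbers. From [4^(e-1) < n] one gets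
    [s^2 = 4^e <= 4 n], so the square of [s^7] is at most [(4 n)^7]. *)
Lemma cost_bound n (e := up_log 4 n) c k : (1 < n)%N ->
  (c <= k * (e + 1) * (2 ^ e) ^ 7)%N ->
  (c ^ 2 <= k ^ 2 * 9 * 4 ^ 7 * n ^ 7 * trunc_log 2 n ^ 2)%N.
Proof.
move=> n1 le_c; set t := trunc_log 2 n.
have e0 : (0 < e)%N by rewrite up_log_gt0.
have lt4 : (4 ^ e.-1 < n)%N by apply: up_log_gtn.
have lt2 : (n < 2 ^ t.+1)%N by apply: trunc_log_ltn.
have t0 : (0 < t)%N by rewrite trunc_log_gt0.
(* From [2 (e - 1) < t + 1] and [t >= 1]. *)
have le_e : (e + 1 <= 3 * t)%N.
  have : (2 ^ (2 * e.-1) < 2 ^ t.+1)%N by rewrite expnM (leq_trans lt4) // ltnW.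
  by rewrite ltn_exp2l //; lia.
have le_s : ((2 ^ e) ^ 2 <= 4 * n)%N.
  by rewrite -expnM mulnC expnM -(prednK e0) expnS leq_mul2l ltnW.
have -> : (k ^ 2 * 9 * 4 ^ 7 * n ^ 7 * t ^ 2 = (k * (3 * t)) ^ 2 * (4 * n) ^ 7)%N.
  by rewrite !expnMn; ring.
apply: (@leq_trans ((k * (e + 1) * (2 ^ e) ^ 7) ^ 2)); first by rewrite leq_exp2r.
rewrite expnMn -expnM mulnC -(mulnC 2) expnM mulnC.
by rewrite leq_mul // leq_exp2r // leq_mul2l le_e orbT.
Qed.

Theorem theorem3 :
  exists (P : nat -> seq instr * seq nat) (C b N0 : nat),
    (forall n : nat,
        slp_wf (n * n) (P n).1 /\ size (P n).2 = (n * n)%N /\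
        all (fun o => (o < n * n + size (P n).1)%N) (P n).2) /\
    (forall (R : comNzRingType) (n : nat) (A : 'M[R]_n) (i j : 'I_n),
        nth 0 (slp_eval (P n).1 (mx_entries A)) (nth 0%N (P n).2 (i * n + j))
        = \adj A i j) /\
    (forall n : nat, (N0 <= n)%N ->
        (slp_cost (P n).1 ^ 2 <= C * n ^ 7 * trunc_log 2 n ^ b)%N).
Proof.
have ex n : (n <= 2 ^ up_log 4 n * 2 ^ up_log 4 n)%N.
  by rewrite -expnMn up_logP.
have [P hP] := functional_choice _ (fun n => adj_slp_exists (ex n)).
(* [N0 = 2] makes the logarithm positive; the exponent 2 is that of [e + 1] after squaring. *)
exists P, ((11 * mul_const) ^ 2 * 9 * 4 ^ 7)%N, 2%N, 2%N.
split; first by move=> n; have [] := hP n.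
split; first by move=> R n A i j; have [] := hP n.
by move=> n n1; apply: cost_bound => //; have [] := hP n.
Qed.
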